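(* Let $\mathcal A=\mathbb Z[v,v^{-1}]$ and let $A$ be a tabular algebra with table datum $(\Lambda,\Gamma,B,M,C,* )$ of finite rank, that is, $|B(\lambda)|<\infty$ for each $\lambda\in\Lambda$. Let $R$ be a commutative ring with identity containing $\mathbb Z$ as a subring. Suppose that $\alpha$ is an $\mathcal A$-algebra automorphism of $A$ such that $\alpha(\operatorname{Im}(C))=\operatorname{Im}(C)$, such that $\alpha\circ *$ squares to the identity, and such that for each $\lambda\in\Lambda$ there exist a permutation $\sigma_\lambda$ of $M(\lambda)$ and an automorphism $f_\lambda$ of the based ring $(\Gamma(\lambda),B(\lambda))$ with $$\alpha(C_{S,T}^b)=C_{\sigma_\lambda(S),\sigma_\lambda(T)}^{f_\lambda(b)}\qquad\text{for all } S,T\in M(\lambda),\ b\in B(\lambda).$$ Suppose that for each $\lambda\in\Lambda$ the algebra $R\otimes_{\mathbb Z}\Gamma(\lambda)$ is cellular over $R$ with cell datum $(\Lambda_\lambda,M_\lambda,C_\lambda,\overline{f_\lambda})$, where $\overline{f_\lambda}$ is the ($R$-linearly extended) composition of $f_\lambda$ with the hypergroup anti-automorphism $\bar{\ }$ of $\Gamma(\lambda)$. Then $R\otimes_{\mathbb Z}A$ is cellular over $R\otimes_{\mathbb Z}\mathcal A$ with cell datum $(\Lambda',M',C',*')$, where: - $\Lambda'=\{(\lambda,\lambda'):\lambda\in\Lambda,\ \lambda'\in\Lambda_\lambda\}$, ordered lexicographically; - $M'((\lambda,\lambda'))=M(\lambda)\times M_\lambda(\lambda')$; - $C'((S,s),(T,t))=C_{S,\sigma_\lambda(T)}^{C_\lambda(s,t)}$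 for $(S,s),(T,t)\in M(\lambda)\times M_\lambda(\lambda')$; - $*'=*\circ\alpha=\alpha\circ *$ (extended linearly), so that $*':C_{S,T}^b\mapsto C_{\sigma_\lambda(T),\sigma_\lambda(S)}^{\overline{f_\lambda}(b)}$.
   Context: **Hypergroup.** A hypergroup over a commutative ring $R\supseteq\mathbb Z$ is a pair $(\Gamma,B)$ with $\Gamma$ an associative unital $R$-algebra and $B=\{b_i\}$ a distinguished $R$-basis with $1\in B$ such that: (H1) structure constants with respect to $B$ are nonnegative integers; (H2) there is an algebra anti-automorphism $\bar{\ }$ of $\Gamma$ with square the identity and $\overline{B}=B$; (H3) if $\kappa(b,a)$ denotes the coefficient of $b\in B$ in $a\in\Gamma$, then $\kappa(b_m,b_ib_j)=\kappa(b_i,b_m\overline{b_j})$ for all $b_i,b_j,b_m\in B$. (The map $\bar{\ }$ is determined by the structure constants.) **Based ring.** A based ring is a pair $(\Gamma,B)$ with $\Gamma$ a unital $\mathbb Z$-algebra with free $\mathbb Z$-basis $B$ and nonnegative structure constants; an automorphism of it is a ring automorphism of $\Gamma$ permuting $B$. Hypergroups over $\mathbb Z$ are based rings. **Cellular algebra.** A cellular algebra over a commutative ring $R$ with $1$ is an associative unital $R$-algebra $A$ with a cell datum $(\Lambda,M,C,* )$ where: (C1) $\Lambda$ is a finite poset, $M(\lambda)$ is a finite set for each $\lambda\in\Lambda$, and $C:\coprod_{\lambda}(M(\lambda)\times M(\lambda))\to A$ is injective with image an $R$-basis of $A$; (C2) writing $C(S,T)=C_{S,T}^\lambda$, $*$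 is an $R$-linear involutory anti-automorphism of $A$ with $(C_{S,T}^\lambda)^*=C_{T,S}^\lambda$; (C3) for $\lambda\in\Lambda$, $S,T\in M(\lambda)$ and $a\in A$, $a\,C_{S,T}^\lambda\equiv\sum_{S'\in M(\lambda)}r_a(S',S)C_{S',T}^\lambda \bmod A(<\lambda)$, where $r_a(S',S)\in R$ is independent of $T$ and $A(<\lambda)$ is the $R$-span of all $C_{S'',T''}^\mu$ with $\mu<\lambda$. **Tabular algebra.** Let $\mathcal A=\mathbb Z[v,v^{-1}]$. A tabular algebra is an $\mathcal A$-algebra $A$ with a table datum $(\Lambda,\Gamma,B,M,C,* )$ where: (A1) $\Lambda$ is a finite poset; for each $\lambda\in\Lambda$, $(\Gamma(\lambda),B(\lambda))$ is a hypergroup over $\mathbb Z$ and $M(\lambda)$ is a finite set; the map $C:\coprod_\lambda(M(\lambda)\times B(\lambda)\times M(\lambda))\to A$ is injective with image an $\mathcal A$-basis of $A$ (a ''tabular basis''); and $\operatorname{Im}(C)$ contains a set of mutually orthogonal idempotents $\{1_\varepsilon:\varepsilon\in\mathcal E\}$ with $A=\sum_{\varepsilon,\varepsilon'}1_\varepsilon A1_{\varepsilon'}$ and such that each $X\in\operatorname{Im}(C)$ satisfies $X=1_\varepsilon X1_{\varepsilon'}$ for some $\varepsilon,\varepsilon'$. (A2) For $S,T\in M(\lambda)$, $b\in B(\lambda)$ write $C_{S,T}^b=C(S,b,T)$. Then $*$ is an $\mathcal A$-linear involutory anti-automorphism of $A$ with $(C_{S,T}^b)^*=C_{T,S}^{\bar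 b}$, where $\bar{\ }$ is the hypergroup anti-automorphism. The notation is extended linearly: for $g=\sum_i c_ib_i$, $C_{S,T}^g=\sum_ic_iC_{S,T}^{b_i}$ (also after extension of scalars). (A3) For $\lambda\in\Lambda$, $g\in\Gamma(\lambda)$, $S,T\in M(\lambda)$, $a\in A$: $a\,C_{S,T}^g\equiv\sum_{S'\in M(\lambda)}C_{S',T}^{r_a(S',S)g}\bmod A(<\lambda)$, where $r_a(S',S)\in\mathcal A\otimes_{\mathbb Z}\Gamma(\lambda)$ is independent of $T$ and $g$, and $A(<\lambda)$ is the $\mathcal A$-span of all $C_{S'',T''}^{b}$ with $S'',T''\in M(\mu)$, $b\in B(\mu)$, $\mu<\lambda$. *)

(* Defs.v *)
From HB Require Import structures.
From mathcomp Require Import all_boot all_order all_fingroup all_algebra.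
From mathcomp Require Import generic_quotient ring_quotient.
From mathcomp Require Import finmap.
From mathcomp Require Import boolp classical_sets.
From mathcomp Require Import freeg.

Set Implicit Arguments.
Unset Strict Implicit.
Unset Printing Implicit Defensive.

Import Order.TTheory GRing.Theory Num.Theory.

Local Open Scope classical_set_scope.
Local Open Scope quotient_scope.
Local Open Scope ring_scope.

(* Z[v, v^-1] is realized as the subring of Z(v) of the fractions p / v^n. *)
Definition is_laurent : pred {fraction {poly int}} := fun x =>
  `[< exists (p : {poly int}) (n : nat), x = tofrac p / tofrac 'X^n >].

Fact is_laurent_subring : subring_closed is_laurent.
Proof.
have X0 n : tofrac ('X^n : {poly int}) != 0.
  by rewrite tofrac_eq0 expf_neq0 // polyX_eq0.
split; rewrite /is_laurent.
- by apply/asboolP; exists 1, 0; rewrite expr0 rmorph1 divr1.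
- move=> _ _ /asboolP[p [n ->]] /asboolP[q [m ->]]; apply/asboolP.
  exists (p * 'X^m - q * 'X^n), (n + m)%N.
  by rewrite -mulNr addf_div // exprD rmorphB !rmorphM /= mulNr.
- move=> _ _ /asboolP[p [n ->]] /asboolP[q [m ->]]; apply/asboolP.
  by exists (p * q), (n + m)%N; rewrite exprD !rmorphM /= mulf_div.
Qed.

HB.instance Definition _ :=
  GRing.isSubringClosed.Build {fraction {poly int}} is_laurent
    is_laurent_subring.

Record laurent := Laurent {
  laurent_val : {fraction {poly int}};
  _ : is_laurent laurent_val
}.

HB.instance Definition _ := [isSub for laurent_val].
HB.instance Definition _ := [Choice of laurent by <:].
HB.instance Definition _ := [SubChoice_isSubComNzRing of laurent by <:].

(* M (x)_Z N is the free abelian group on M * N modulo biadditivity. *)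
Section TensorDef.
Variables M N : zmodType.

Let fg (m : M) (n : N) : {freeg (M * N)%type} := << (m, n) >>.

Inductive tens_rel : {freeg (M * N)%type} -> Prop :=
| tens_rel0 : tens_rel 0
| tens_relB x y : tens_rel x -> tens_rel y -> tens_rel (x - y)
| tens_relDl m m' n : tens_rel (fg (m + m') n - fg m n - fg m' n)
| tens_relDr m n n' : tens_rel (fg m (n + n') - fg m n - fg m n').

Definition tens_relb : pred {freeg (M * N)%type} := fun x => `[< tens_rel x >].

Fact tens_relb_closed : zmod_closed tens_relb.
Proof.
split; first exact/asboolP/tens_rel0.
by move=> x y /asboolP hx /asboolP hy; apply/asboolP/tens_relB.
Qed.

HB.instance Definition _ :=
  GRing.isZmodClosed.Build {freeg (M * N)%type} tens_relb tens_relb_closed.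

Definition tens_sub : zmodClosed {freeg (M * N)%type} :=
  GRing.ZmodClosed.clone _ tens_relb _.

Let relQ := Quotient.quot tens_sub.

Definition tens : Type := relQ.
HB.instance Definition _ := GRing.Zmodule.on tens.

Definition tpure (m : M) (n : N) : tens := \pi_relQ (fg m n).

(* Meaningful only when f is biadditive. *)
Definition tens_lift (P : zmodType) (f : M -> N -> P) (t : tens) : P :=
  fglift (fun p : M * N => f p.1 p.2 : zmodule P)
    (repr (t : relQ)).

End TensorDef.

Notation "m \ox n" := (tpure m n) (at level 40, left associativity).

Section TensorTheory.
Variables M N : zmodType.
Implicit Types (m : M) (n : N) (t : tens M N).

Definition biadditive (P : zmodType) (f : M -> N -> P) :=
  (forall m m' n, f (m + m') n = f m n + f m' n) /\
  (forall m n n', f m (n + n') = f m n + f m n').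

Let relQ := Quotient.quot (tens_sub M N).
Let pi (x : {freeg (M * N)%type}) : tens M N := \pi_relQ x.

Fact tens_piB x y : pi (x - y) = pi x - pi y.
Proof. exact: (@pi_is_zmod_morphism _ _ _ relQ). Qed.

Fact tens_pi0 : pi 0 = 0.
Proof. by rewrite -[X in pi X](subrr 0) tens_piB subrr. Qed.

Fact tens_piP x y : reflect (pi x = pi y) (tens_relb (x - y)).
Proof.
apply: (iffP idP) => [h|/eqmodP h]; last exact: h.
by apply/eqmodP; rewrite /= /Quotient.equiv /=.
Qed.

Lemma tpureDl m m' n : (m + m') \ox n = m \ox n + m' \ox n.
Proof.
have /tens_piP h : tens_relb (<< (m + m', n) >> - << (m, n) >> - << (m', n) >> - 0).
  by rewrite subr0; apply/asboolP; exact: tens_relDl.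
move: h; rewrite !tens_piB tens_pi0 => /eqP.
by rewrite !subr_eq add0r => /eqP h; rewrite [RHS]addrC; exact: h.
Qed.

Lemma tpureDr m n n' : m \ox (n + n') = m \ox n + m \ox n'.
Proof.
have /tens_piP h : tens_relb (<< (m, n + n') >> - << (m, n) >> - << (m, n') >> - 0).
  by rewrite subr0; apply/asboolP; exact: tens_relDr.
move: h; rewrite !tens_piB tens_pi0 => /eqP.
by rewrite !subr_eq add0r => /eqP h; rewrite [RHS]addrC; exact: h.
Qed.

Lemma tpure_biadditive : biadditive (@tpure M N).
Proof. by split=> *; rewrite ?tpureDl ?tpureDr. Qed.

Lemma tpure0l n : 0 \ox n = 0 :> tens M N.
Proof. by apply: (addrI (0 \ox n)); rewrite -tpureDl !addr0. Qed.

Lemma tpure0r m : m \ox 0 = 0 :> tens M N.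
Proof. by apply: (addrI (m \ox 0)); rewrite -tpureDr !addr0. Qed.

Lemma tpureNl m n : (- m) \ox n = - (m \ox n).
Proof. by apply: (addrI (m \ox n)); rewrite -tpureDl !subrr tpure0l. Qed.

Lemma tens_ind (Q : tens M N -> Prop) :
  (forall m n, Q (m \ox n)) -> (forall t u, Q t -> Q u -> Q (t + u)) ->
  forall t, Q t.
Proof.
move=> Qp Qadd t; rewrite -[t](@reprK _ relQ).
have Q0 : Q 0 by rewrite -(tpure0l 0).
set x := repr _; rewrite -/(pi x) -(freeg_sumE x).
have piD y z : pi (y + z) = pi y + pi z.
  exact: (raddfD (\pi_relQ)).
elim: (dom x) => [|[m n] s IH]; first by rewrite big_nil tens_pi0.
rewrite big_cons piD; apply: (Qadd) => //.
have pos k p q : Q (pi << k%:Z *g (p, q) >>).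
  elim: k => [|k IHk]; first by rewrite freegU0 tens_pi0.
  by rewrite -addn1 PoszD -freegUD piD; apply: (Qadd); [exact: IHk|exact: Qp].
case: (coeff _ _) => [k|k]; first exact: pos.
rewrite NegzE -freegUN -[X in pi X]sub0r tens_piB tens_pi0 sub0r.
have -> : - pi << (k.+1)%:Z *g (m, n) >> = pi << (k.+1)%:Z *g (- m, n) >>.
  have e : forall j : nat, pi << j%:Z *g (m, n) >> = - pi << j%:Z *g (- m, n) >>.
    elim=> [|j IHj]; first by rewrite !freegU0 tens_pi0 oppr0.
    rewrite -addn1 PoszD -!freegUD !piD IHj opprD; congr (_ + _).
    by rewrite -[LHS]opprK; congr (- _); rewrite -[LHS]tpureNl.
  by rewrite e opprK.
exact: pos.
Qed.

Section Lift.
Variables (P : zmodType) (f : M -> N -> P).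
Hypothesis f_biadd : biadditive f.

Let g : {freeg (M * N)%type} -> zmodule P := fglift (fun p : M * N => f p.1 p.2 : zmodule P).

Let gB x y : g (x - y) = g x - g y.
Proof. exact: lift_is_additive. Qed.

Let gU m n : g << (m, n) >> = f m n.
Proof. by rewrite /g liftU scale1r. Qed.

Let g_rel x : tens_rel x -> g x = 0.
Proof.
case: f_biadd => fDl fDr.
elim=> [|{}x y _ gx _ gy|m m' n|m n n'].
- by rewrite -[0](subrr 0) gB subrr.
- by rewrite gB gx gy subrr.
- by rewrite !gB !gU fDl addrAC addrK subrr.
- by rewrite !gB !gU fDr addrAC addrK subrr.
Qed.

Fact tens_lift_pi x : tens_lift f (pi x) = g x.
Proof.
apply/eqP; rewrite -subr_eq0 -/(g _) -gB; apply/eqP/g_rel/asboolP.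
by apply/tens_piP; rewrite /pi reprK.
Qed.

Lemma tens_liftE m n : tens_lift f (m \ox n) = f m n.
Proof. by rewrite tens_lift_pi gU. Qed.

Lemma tens_liftB t u : tens_lift f (t - u) = tens_lift f t - tens_lift f u.
Proof.
rewrite -[t](@reprK _ relQ).
rewrite -[u](@reprK _ relQ).
by rewrite -!/(pi _) -tens_piB !tens_lift_pi gB.
Qed.

Lemma tens_lift0 : tens_lift f 0 = 0.
Proof. by rewrite -[X in tens_lift f X](subrr 0) tens_liftB subrr. Qed.

Lemma tens_liftD t u : tens_lift f (t + u) = tens_lift f t + tens_lift f u.
Proof.
by rewrite -[u in LHS]opprK -[- u]sub0r !tens_liftB tens_lift0 sub0r opprK.
Qed.

End Lift.
End TensorTheory.

(* id (x) h, for an additive map h. *)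
Definition tens_ext (R M N : zmodType) (h : M -> N) : tens R M -> tens R N :=
  tens_lift (fun r m => r \ox h m).

Section TensorRing.
Variables R A : pzRingType.

Definition tens_mul (x y : tens R A) : tens R A :=
  tens_lift (fun r a => tens_lift (fun s b => (r * s) \ox (a * b)) y) x.

Let inner_biadd r a : biadditive (fun s b => (r * s) \ox (a * b) : tens R A).
Proof. by split=> *; rewrite mulrDr ?tpureDl ?tpureDr. Qed.

Let outer_biadd y : biadditive (fun r a =>
  tens_lift (fun s b => (r * s) \ox (a * b) : tens R A) y).
Proof.
by split=> *; elim/tens_ind: y => [s b|t u IHt IHu]; do ?
  [by rewrite !tens_liftE // mulrDl ?tpureDl ?tpureDr
  |by rewrite !tens_liftD // IHt IHu addrACA].
Qed.

Lemma tens_mulE r s a b :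
  tens_mul (r \ox a) (s \ox b) = (r * s) \ox (a * b).
Proof. by rewrite /tens_mul !tens_liftE. Qed.

Fact tens_mulDl : left_distributive tens_mul +%R.
Proof. by move=> x y z; rewrite /tens_mul tens_liftD. Qed.

Fact tens_mulDr : right_distributive tens_mul +%R.
Proof.
move=> x y z; elim/tens_ind: x => [r a|t u IHt IHu].
  by rewrite /tens_mul !tens_liftE // tens_liftD.
by rewrite !tens_mulDl IHt IHu addrACA.
Qed.

Fact tens_mulA : associative tens_mul.
Proof.
move=> x y z; elim/tens_ind: x => [r a|t u IHt IHu]; last first.
  by rewrite !tens_mulDl IHt IHu.
elim/tens_ind: y => [s b|t u IHt IHu]; last first.
  by rewrite !(tens_mulDl, tens_mulDr) IHt IHu.
elim/tens_ind: z => [q c|t u IHt IHu]; last by rewrite !tens_mulDr IHt IHu.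
by rewrite !tens_mulE !mulrA.
Qed.

Fact tens_mul1 : left_id (1 \ox 1) tens_mul.
Proof.
move=> x; elim/tens_ind: x => [r a|t u IHt IHu]; last first.
  by rewrite tens_mulDr IHt IHu.
by rewrite tens_mulE !mul1r.
Qed.

Fact tens_mulr1 : right_id (1 \ox 1) tens_mul.
Proof.
move=> x; elim/tens_ind: x => [r a|t u IHt IHu]; last first.
  by rewrite tens_mulDl IHt IHu.
by rewrite tens_mulE !mulr1.
Qed.

HB.instance Definition _ := GRing.Zmodule_isPzRing.Build (tens R A)
  tens_mulA tens_mul1 tens_mulr1 tens_mulDl tens_mulDr.

Lemma tpureM r s (a b : A) :
  (r \ox a) * (s \ox b) = (r * s) \ox (a * b) :> tens R A.
Proof. exact: tens_mulE. Qed.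

End TensorRing.

Section TensorComRing.
Variables R S : comPzRingType.

Fact tens_mulC : commutative (@tens_mul R S).
Proof.
move=> x y; elim/tens_ind: x => [r a|t u IHt IHu]; last first.
  by rewrite tens_mulDl tens_mulDr IHt IHu.
elim/tens_ind: y => [s b|t u IHt IHu]; last first.
  by rewrite tens_mulDl tens_mulDr IHt IHu.
by rewrite !tens_mulE mulrC [a * b]mulrC.
Qed.

HB.instance Definition _ := GRing.PzRing_hasCommutativeMul.Build (tens R S)
  tens_mulC.

End TensorComRing.

(* An associative unital algebra is a ring, possibly zero, with a ring
   morphism from the scalars to its center; GRing.Algebra excludes the zero
   ring, and the same ring R (x) A is used over both R and R (x) S. *)
Record algebra (R : comPzRingType) := Algebra {
  alg_sort :> pzRingType;
  alg_map : {rmorphism R -> alg_sort};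
  alg_mapC : forall r a, alg_map r * a = a * alg_map r
}.

Definition ascale (R : comPzRingType) (A : algebra R) (r : R) (a : A) : A :=
  alg_map A r * a.

Notation "r *a x" := (ascale r x) (at level 40, left associativity).

(* R (x)_Z A as an R-algebra *)
Section ScalarExtension.
Variables (R : comPzRingType) (A : pzRingType).

Definition ext_map (r : R) : tens R A := r \ox 1.

Fact ext_map_zmod : zmod_morphism ext_map.
Proof. by move=> r s; rewrite /ext_map tpureDl tpureNl. Qed.

Fact ext_map_monoid : monoid_morphism ext_map.
Proof. by split=> // r s; rewrite /ext_map tpureM mulr1. Qed.

HB.instance Definition _ :=
  GRing.isZmodMorphism.Build R (tens R A) ext_map ext_map_zmod.
HB.instance Definition _ :=
  GRing.isMonoidMorphism.Build R (tens R A) ext_map ext_map_monoid.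

Fact ext_mapC r x : ext_map r * x = x * ext_map r.
Proof.
elim/tens_ind: x => [s a|t u IHt IHu]; last by rewrite mulrDl mulrDr IHt IHu.
by rewrite !tpureM mulr1 mul1r mulrC.
Qed.

Definition ext_alg : algebra R := Algebra ext_mapC.

End ScalarExtension.

(* R (x)_Z A as an algebra over R (x)_Z S, for an S-algebra A *)
Section TensorAlgebra.
Variables (R S : comPzRingType) (A : algebra S).

Definition tens_map : tens R S -> tens R A := tens_ext (alg_map A).

Fact tens_map_biadd :
  biadditive (fun (r : R) (s : S) => r \ox alg_map A s : tens R A).
Proof. by split=> *; rewrite ?rmorphD ?tpureDl ?tpureDr. Qed.

Fact tens_map_zmod : zmod_morphism tens_map.
Proof. by move=> x y; rewrite /tens_map /tens_ext tens_liftB //; exact: tens_map_biadd. Qed.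

Lemma tens_mapE r s : tens_map (r \ox s) = r \ox alg_map A s.
Proof. by rewrite /tens_map /tens_ext tens_liftE //; exact: tens_map_biadd. Qed.

HB.instance Definition _ :=
  GRing.isZmodMorphism.Build (tens R S) (tens R A) tens_map tens_map_zmod.

Fact tens_map_monoid : monoid_morphism tens_map.
Proof.
split; first by rewrite [1 in LHS]/(1 \ox 1) tens_mapE rmorph1.
move=> x y; elim/tens_ind: x => [r s|t u IHt IHu]; last first.
  by rewrite mulrDl !raddfD mulrDl /= IHt IHu.
elim/tens_ind: y => [r' s'|t u IHt IHu]; last first.
  by rewrite mulrDr !raddfD mulrDr /= IHt IHu.
by rewrite tpureM !tens_mapE tpureM rmorphM.
Qed.

HB.instance Definition _ :=
  GRing.isMonoidMorphism.Build (tens R S) (tens R A) tens_map tens_map_monoid.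

Fact tens_mapC x (y : tens R A) : tens_map x * y = y * tens_map x.
Proof.
elim/tens_ind: x => [r s|t u IHt IHu]; last first.
  by rewrite raddfD mulrDl mulrDr /= IHt IHu.
elim/tens_ind: y => [r' a|t u IHt IHu]; last first.
  by rewrite mulrDl mulrDr /= IHt IHu.
by rewrite tens_mapE !tpureM alg_mapC mulrC.
Qed.

Definition tens_alg : algebra (tens R S) := Algebra tens_mapC.

End TensorAlgebra.

Section Bases.
Variables (R : comPzRingType) (A : algebra R) (I : choiceType) (b : I -> A).

Definition lcomb (c : {fsfun I -> R with 0}) : A :=
  \sum_(i <- finsupp c) c i *a b i.

Definition is_basis := forall a : A, exists! c, lcomb c = a.

(* The coordinates of a on b (meaningful when b is a basis). *)
Definition coords (a : A) : {fsfun I -> R with 0} :=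
  xget [fsfun] [set c | lcomb c = a].

Definition kappa (i : I) (a : A) : R := coords a i.

End Bases.

(* The R-linear map A -> A' extending b i |-> phi i. *)
Definition lin_ext (R : comPzRingType) (A A' : algebra R) (I : choiceType)
    (b : I -> A) (phi : I -> A') (a : A) : A' :=
  lcomb phi (coords b a).

Definition lspan (R : comPzRingType) (A : algebra R) (X : set A) : set A :=
  [set a | exists s : seq (R * A),
     (forall p, p \in s -> X p.2) /\ a = \sum_(p <- s) p.1 *a p.2].

Definition is_linear (R : comPzRingType) (A : algebra R) (h : A -> A) :=
  forall r x y, h (r *a x + y) = r *a h x + h y.

Definition alg_automorphism (R : comPzRingType) (A : algebra R) (h : A -> A) :=
  [/\ is_linear h, monoid_morphism h & bijective h].

Definition anti_involution (R : comPzRingType) (A : algebra R) (h : A -> A) :=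
  [/\ is_linear h, {morph h : x y / x * y >-> y * x} & involutive h].

Record based (R : comPzRingType) (G : algebra R) (I : choiceType)
    (b : I -> G) : Prop := {
  based_inj : injective b;
  based_basis : is_basis b;
  based_nonneg : forall i j k, exists n : nat, kappa b k (b i * b j) = n%:R
}.

Record based_automorphism (R : comPzRingType) (G : algebra R) (I : choiceType)
    (b : I -> G) (f : G -> G) : Prop := {
  baut_zmod : zmod_morphism f;
  baut_monoid : monoid_morphism f;
  baut_bij : bijective f;
  baut_range : f @` range b = range b
}.

Record hypergroup (R : comPzRingType) (G : algebra R) (I : choiceType)
    (b : I -> G) (bar : G -> G) : Prop := {
  hyp_based : based b;
  hyp_one : range b 1;
  hyp_bar : anti_involution bar;
  hyp_bar_range : bar @` range b = range b;
  hyp_kappa : forall i j m,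
    kappa b m (b i * b j) = kappa b i (b m * bar (b j))
}.

Section Cellular.
Variables (R : comPzRingType) (A : algebra R) (d : Order.disp_t)
  (L : finPOrderType d) (M : L -> finType) (C : forall l, M l -> M l -> A)
  (star : A -> A).

Definition cell_fun (x : {l : L & (M l * M l)%type}) : A :=
  C (tagged x).1 (tagged x).2.

Definition cell_below (l : L) : set A :=
  lspan [set a | exists m (S T : M m), (m < l)%O /\ a = C S T].

Record cellular : Prop := {
  cell_inj : injective cell_fun;
  cell_basis : is_basis cell_fun;
  cell_star : anti_involution star;
  cell_starE : forall l (S T : M l), star (C S T) = C T S;
  cell_mul : forall l (a : A), exists r : M l -> M l -> R,
    forall S T : M l,
      cell_below l (a * C S T - \sum_(S' : M l) r S' S *a C S' T)
}.

End Cellular.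

Section Tabular.
Variables (A : algebra laurent) (d : Order.disp_t) (L : finPOrderType d)
  (G : L -> algebra int) (B : L -> choiceType) (b : forall l, B l -> G l)
  (bar : forall l, G l -> G l) (M : L -> finType)
  (C : forall l, M l -> B l -> M l -> A) (star : A -> A).

Definition tab_fun (x : {l : L & (M l * B l * M l)%type}) : A :=
  C (tagged x).1.1 (tagged x).1.2 (tagged x).2.

(* C_{S,T}^g, for g in Z[v, v^-1] (x) G l *)
Definition tab_ext (l : L) (S T : M l) (g : ext_alg laurent (G l)) : A :=
  lin_ext (fun i => 1 \ox b i : ext_alg laurent (G l)) (fun i => C S i T) g.

Definition tab_below (l : L) : set A :=
  lspan [set a | exists m (S : M m) (i : B m) (T : M m),
    (m < l)%O /\ a = C S i T].

(* The set E is that of the idempotents 1_eps. *)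
Definition tab_idempotents : Prop := exists E : set A,
  [/\ E `<=` range tab_fun,
      forall e, E e -> e * e = e,
      forall e e', E e -> E e' -> e <> e' -> e * e' = 0,
      forall a, exists s : seq A, a = \sum_(x <- s) x /\
        forall x, x \in s ->
          exists e e' y, [/\ E e, E e' & x = e * y * e']
    & forall x, range tab_fun x ->
        exists e e', [/\ E e, E e' & x = e * x * e']].

Record tabular : Prop := {
  tab_hyp : forall l, hypergroup (b (l := l)) (bar (l := l));
  tab_inj : injective tab_fun;
  tab_basis : is_basis tab_fun;
  tab_idem : tab_idempotents;
  tab_star : anti_involution star;
  tab_starE : forall l (S T : M l) (i : B l),
    star (C S i T) = tab_ext T S (1 \ox bar (b i));
  tab_mul : forall l (a : A), exists r : M l -> M l -> ext_alg laurent (G l),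
    forall (g : G l) (S T : M l),
      tab_below l (a * tab_ext S T (1 \ox g)
                   - \sum_(S' : M l) tab_ext S' T (r S' S * (1 \ox g)))
}.

End Tabular.

(* Extension of C_{S,T}^g to g in R (x) G l; its values are in R (x) A. *)
Definition tab_extR (R : comPzRingType) (A : algebra laurent) (d : Order.disp_t)
    (L : finPOrderType d) (G : L -> algebra int) (B : L -> choiceType)
    (b : forall l, B l -> G l) (M : L -> finType)
    (C : forall l, M l -> B l -> M l -> A)
    (l : L) (S T : M l) (g : ext_alg R (G l)) : ext_alg R A :=
  lin_ext (fun i => 1 \ox b l i : ext_alg R (G l))
    (fun i => 1 \ox C l S i T : ext_alg R A) g.

(* Main.v *)
Require Import Defs.
From HB Require Import structures.
From mathcomp Require Import all_boot all_order all_fingroup all_algebra.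
From mathcomp Require Import finmap boolp classical_sets.

Set Implicit Arguments.
Unset Strict Implicit.
Unset Printing Implicit Defensive.

Import Order.TTheory GRing.Theory Num.Theory.

Local Open Scope classical_set_scope.
Local Open Scope ring_scope.

(** Write phi_{S,T} : R (x) G l -> R (x) A for the extension g |-> C_{S,T}^g.
It is semilinear along the map r |-> r (x) 1 from R to R (x) Z[v, 1/v], and
sends 1 (x) b_i to 1 (x) C_{S,T}^i.  Since the C_{S,T}^i form a basis of A, the
space R (x) A is the direct sum of the R (x) Z[v, 1/v]-spans of the images of
the phi_{S,T}, each of which is a copy of R (x) G l with extended scalars.  The
candidate cell basis is phi_{S, sigma T} applied to a cell basis D of R (x) G l.

- It is a basis because it arises in each summand from a change of basis over
  R, and T |-> sigma T only permutes the summands ([tab_cell_is_basis]).  The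
  elements are distinct because R (x) Z[v, 1/v] is not the zero ring: setting
  v = 1 maps it onto R ([tens_laurent_neq0]).

- The twisted involution reverses the roles of the two indices.  It sends
  phi_{S,T} g to phi_{sigma T, sigma S} applied to the image of g under the
  involution of R (x) G l ([tens_star_extR]), so the image of
  phi_{S, sigma T} D(s,t) is phi_{sigma (sigma T), sigma S} D(t,s).  This is
  the required element because sigma is an involution ([sigma_involutive]).
  The reason is that alpha commutes with the involution of A
  ([star_alphaC]), because an automorphism of a based ring commutes with the
  hypergroup involution, which is determined by the structure constants, b_i
  and bar b_j being equal exactly when 1 occurs in b_i b_j
  ([based_aut_bar]).  Since the composite of alpha with the involution of A
  squares to 1, so does alpha, and then sigma.

- For the multiplication rule ([tab_cell_mul]), expand the tabular structure
  constants on the basis, r_a(S',S) = sum_k p_k b_k.  Modulo the part of R (x) A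
  lying strictly below l,
    a phi_{S,T} g = sum_{S'} sum_k p_k phi_{S',T} (b_k g),
  which holds for all g by linearity ([tab_mul_extR]).  For g = D(s,t), the
  product b_k D(s,t) is in turn a combination of the D(s',t), with coefficients
  independent of t, modulo lower elements of R (x) G l.  Both error terms lie
  below (l,l') in the lexicographic order. *)

(** * Additive maps *)

Lemma morphD0 (U V : zmodType) (h : U -> V) :
  {morph h : x y / x + y} -> h 0 = 0.
Proof. by move=> hD; apply: (addrI (h 0)); rewrite -hD !addr0. Qed.

Lemma morphD_sum (U V : zmodType) (h : U -> V) (I : Type) (r : seq I)
    (P : pred I) (F : I -> U) :
  {morph h : x y / x + y} ->
  h (\sum_(i <- r | P i) F i) = \sum_(i <- r | P i) h (F i).
Proof. by move=> hD; apply: (big_morph h hD (morphD0 hD)). Qed.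

Lemma morphDB (U V : zmodType) (h : U -> V) :
  {morph h : x y / x + y} -> {morph h : x y / x - y}.
Proof. by move=> hD x y; apply: (addIr (h y)); rewrite -hD !subrK. Qed.

Lemma morphD_mulz (U V : zmodType) (h : U -> V) (z : int) x :
  {morph h : x y / x + y} -> h (x *~ z) = h x *~ z.
Proof.
move=> hD; have hn n : h (x *+ n) = h x *+ n.
  by elim: n => [|n IH]; rewrite ?(morphD0 hD) // !mulrS hD IH.
case: z => n; first exact: hn.
rewrite NegzE !mulrNz -sub0r (morphDB hD) (morphD0 hD) sub0r.
by rewrite -[_ *~ _]/(_ *+ _) hn.
Qed.

(** * Modules over a commutative ring *)

Section Scaling.
Variables (R : comPzRingType) (A : algebra R).
Implicit Types (r s : R) (x y : A).

Lemma ascaleDr r x y : r *a (x + y) = r *a x + r *a y.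
Proof. exact: mulrDr. Qed.

Lemma ascaleDl r s x : (r + s) *a x = r *a x + s *a x.
Proof. by rewrite /ascale rmorphD mulrDl. Qed.

Lemma ascaleA r s x : r *a (s *a x) = (r * s) *a x.
Proof. by rewrite /ascale rmorphM mulrA. Qed.

Lemma ascale1 x : 1 *a x = x.
Proof. by rewrite /ascale rmorph1 mul1r. Qed.

Lemma ascale0 x : 0 *a x = 0.
Proof. by rewrite /ascale rmorph0 mul0r. Qed.

Lemma ascaleBr r x y : r *a (x - y) = r *a x - r *a y.
Proof. exact: mulrBr. Qed.

Lemma ascale_sumr (I : Type) (t : seq I) (P : pred I) r (F : I -> A) :
  r *a (\sum_(i <- t | P i) F i) = \sum_(i <- t | P i) r *a F i.
Proof. exact: mulr_sumr. Qed.

Lemma ascale_suml (I : Type) (t : seq I) (P : pred I) (F : I -> R) x :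
  (\sum_(i <- t | P i) F i) *a x = \sum_(i <- t | P i) F i *a x.
Proof. by rewrite /ascale rmorph_sum mulr_suml. Qed.

Lemma ascaleAl r x y : (r *a x) * y = r *a (x * y).
Proof. by rewrite /ascale mulrA. Qed.

Lemma ascaleAr r x y : x * (r *a y) = r *a (x * y).
Proof. by rewrite /ascale mulrA -alg_mapC mulrA. Qed.

Lemma sum_delta (I : finType) (F : I -> A) (j : I) :
  \sum_i (i == j)%:R *a F i = F j.
Proof.
rewrite (bigD1 j) //= eqxx ascale1 big1 ?addr0 // => i /negPf->.
by rewrite ascale0.
Qed.

End Scaling.

(** The way scalars act on the target is a parameter s, so that one notion covers
endomorphisms of an algebra, coordinate forms (s is the multiplication of R)
and maps between algebras over different rings (s is the action through a map
of scalars). *)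
Definition semilin (R : comPzRingType) (A : algebra R) (V : zmodType)
    (s : R -> V -> V) (h : A -> V) :=
  {morph h : x y / x + y} /\ forall r x, h (r *a x) = s r (h x).

Section Semilinear.
Variables (R : comPzRingType) (A : algebra R).

Lemma semilin_sum (V : zmodType) (s : R -> V -> V) (h : A -> V)
    (I : Type) (t : seq I) (P : pred I) (c : I -> R) (F : I -> A) :
  semilin s h ->
  h (\sum_(i <- t | P i) c i *a F i) = \sum_(i <- t | P i) s (c i) (h (F i)).
Proof.
by case=> hD hZ; rewrite morphD_sum //; apply: eq_bigr => i _; rewrite hZ.
Qed.

Lemma semilin_is_linear (h : A -> A) :
  semilin (@ascale R A) h <-> is_linear h.
Proof.
split=> [[hD hZ] r x y|h_lin]; first by rewrite hD hZ.
have hD : {morph h : x y / x + y}.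
  by move=> x y; rewrite -[x in LHS]ascale1 h_lin ascale1.
by split=> // r x; rewrite -[r *a x]addr0 h_lin (morphD0 hD) addr0.
Qed.

End Semilinear.

(** * Bases and their coordinate forms *)

Section DualBasis.
Variables (R : comPzRingType) (A : algebra R) (I : finType).
Implicit Types (b : I -> A) (K : I -> A -> R).

(** A finite family is a basis as soon as linear forms K_i with these properties
exist.  Forms are easy to transport along tensor products, whereas unique
existence of coordinates is not. *)
Record dual_basis b K : Prop := DualBasis {
  dual_linear : forall i, semilin (@GRing.mul R) (K i);
  dual_sum : forall a, a = \sum_i K i a *a b i;
  dual_delta : forall i j, K i (b j) = (i == j)%:R
}.

Lemma lcombE b (c : {fsfun I -> R with 0}) : lcomb b c = \sum_i c i *a b i.
Proof.
rewrite /lcomb big_uniq ?fset_uniq //=.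
rewrite [RHS](bigID [pred i | i \in finsupp c]) /=.
rewrite [X in _ = _ + X]big1 ?addr0 // => i /fsfun_dflt->.
by rewrite ascale0.
Qed.

Let fsfun_of (c : I -> R) : {fsfun I -> R with 0} :=
  [fsfun i in [fset i | i : I]%fset => c i].

Let fsfun_ofE c i : fsfun_of c i = c i.
Proof. by rewrite fsfunE in_imfset. Qed.

Lemma lcomb_coords b a : is_basis b -> lcomb b (coords b a) = a.
Proof.
case/(_ a)=> c [ca _].
by apply: (@xgetPex _ [fsfun] [set c | lcomb b c = a]); exists c.
Qed.

Lemma kappa_unique b (c : I -> R) :
  is_basis b -> forall i, kappa b i (\sum_i c i *a b i) = c i.
Proof.
move=> b_basis i; set a := \sum_i _.
have [c0 [_ c0_uniq]] := b_basis a.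
have ca : lcomb b (fsfun_of c) = a.
  by rewrite lcombE; apply: eq_bigr => j _; rewrite fsfun_ofE.
rewrite /kappa -[RHS]fsfun_ofE -(c0_uniq _ ca).
by rewrite (c0_uniq (coords b a)) // lcomb_coords.
Qed.

Lemma kappa_sum b a : is_basis b -> a = \sum_i kappa b i a *a b i.
Proof. by move=> b_basis; rewrite -lcombE lcomb_coords. Qed.

Lemma kappa_dual b : is_basis b -> dual_basis b (kappa b).
Proof.
move=> b_basis; split=> [i|a|i j]; last 2 first.
- exact: kappa_sum.
- by rewrite -{1}(sum_delta b j) kappa_unique.
split=> [x y|r x].
  rewrite {1}(kappa_sum x b_basis) {1}(kappa_sum y b_basis) -big_split /=.
  under eq_bigr do rewrite -ascaleDl.
  by rewrite kappa_unique.
rewrite {1}(kappa_sum x b_basis) ascale_sumr.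
under eq_bigr do rewrite ascaleA.
by rewrite kappa_unique.
Qed.

Lemma dual_is_basis b K : dual_basis b K -> is_basis b.
Proof.
case=> K_lin K_sum K_delta a; exists (fsfun_of (K^~ a)); split.
  by rewrite lcombE [RHS]K_sum; apply: eq_bigr => i _; rewrite fsfun_ofE.
move=> c <-; apply/fsfunP => i; rewrite fsfun_ofE lcombE.
rewrite (semilin_sum _ _ _ _ (K_lin i)) (bigD1 i) //= K_delta eqxx mulr1.
rewrite big1 ?addr0 // => j /negPf ji.
by rewrite K_delta eq_sym ji mulr0.
Qed.

Lemma dual_inj b K : (1 : R) != 0 -> dual_basis b K -> injective b.
Proof.
move=> R1 [_ _ K_delta] i j eq_b; apply/eqP; move: (K_delta i j).
by rewrite -eq_b K_delta eqxx; case: eqP => // _ /eqP; rewrite (negPf R1).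
Qed.

Lemma semilin_basis_eq (V : zmodType) (s : R -> V -> V) (h h' : A -> V) b :
  is_basis b -> semilin s h -> semilin s h' ->
  (forall i, h (b i) = h' (b i)) -> h =1 h'.
Proof.
move=> b_basis h_lin h'_lin eq_h a.
rewrite (kappa_sum a b_basis) (semilin_sum _ _ _ _ h_lin).
by rewrite (semilin_sum _ _ _ _ h'_lin); apply: eq_bigr => i _; rewrite eq_h.
Qed.

Lemma lin_extE (A' : algebra R) b (phi : I -> A') a :
  lin_ext b phi a = \sum_i kappa b i a *a phi i.
Proof.
rewrite /lin_ext /lcomb big_uniq ?fset_uniq //=.
rewrite [RHS](bigID [pred i | i \in finsupp (coords b a)]) /=.
rewrite [X in _ = _ + X]big1 ?addr0 // => i /fsfun_dflt.
by rewrite /kappa => ->; rewrite ascale0.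
Qed.

Lemma lin_ext_basis (A' : algebra R) b (phi : I -> A') i :
  is_basis b -> lin_ext b phi (b i) = phi i.
Proof.
case/kappa_dual=> _ _ delta; rewrite lin_extE -[RHS]sum_delta.
by apply: eq_bigr => j _; rewrite delta.
Qed.

Lemma lin_ext_semilin (A' : algebra R) b (phi : I -> A') :
  is_basis b -> semilin (@ascale R A') (lin_ext b phi).
Proof.
case/kappa_dual=> K_lin _ _; split=> [x y|r x]; rewrite !lin_extE.
  rewrite -big_split; apply: eq_bigr => i _ /=.
  by rewrite -ascaleDl (K_lin i).1.
by rewrite ascale_sumr; apply: eq_bigr => i _; rewrite (K_lin i).2 ascaleA.
Qed.

End DualBasis.

(** * Linear spans *)

Section Span.
Variables (R : comPzRingType) (A : algebra R).
Implicit Types (X : set A) (x y : A) (r : R).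

Lemma lspan_gen X x : X x -> lspan X x.
Proof.
exists [:: (1, x)]; split=> [p|]; first by rewrite inE => /eqP->.
by rewrite big_seq1 /= ascale1.
Qed.

Lemma lspan0 X : lspan X 0.
Proof. by exists [::]; split=> //; rewrite big_nil. Qed.

Lemma lspanD X x y : lspan X x -> lspan X y -> lspan X (x + y).
Proof.
move=> [s [Xs ->]] [t [Xt ->]]; exists (s ++ t); rewrite big_cat; split=> // p.
by rewrite mem_cat => /orP[/Xs|/Xt].
Qed.

Lemma lspanZ X r x : lspan X x -> lspan X (r *a x).
Proof.
move=> [s [Xs ->]]; exists [seq (r * p.1, p.2) | p <- s]; split.
  by move=> p /mapP[q /Xs Xq ->].
by rewrite ascale_sumr big_map; apply: eq_bigr => p _; rewrite ascaleA.
Qed.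

Lemma lspan_sum X (I : Type) (t : seq I) (P : pred I) (F : I -> A) :
  (forall i, P i -> lspan X (F i)) -> lspan X (\sum_(i <- t | P i) F i).
Proof. by apply: big_ind => [|x y]; [exact: lspan0|exact: lspanD]. Qed.

End Span.

Lemma semilin_lspan (R R' : comPzRingType) (A : algebra R) (A' : algebra R')
    (tau : R -> R') (h : A -> A') (X : set A) (Y : set A') :
  semilin (fun r => ascale (tau r)) h ->
  (forall x, X x -> lspan Y (h x)) -> forall x, lspan X x -> lspan Y (h x).
Proof.
move=> h_lin XY _ [s [Xs ->]]; rewrite (semilin_sum _ _ _ _ h_lin) big_seq.
by apply: lspan_sum => p sp; apply/lspanZ/XY/Xs.
Qed.

(** On a spanning family the forms K_i already read off the coefficients of any
expression of a, which gives the expansion of a. *)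
Lemma dual_basis_of_span (R : comPzRingType) (A : algebra R) (I : finType)
    (b : I -> A) (K : I -> A -> R) :
  (forall i, semilin (@GRing.mul R) (K i)) ->
  (forall i j, K i (b j) = (i == j)%:R) ->
  (forall a, lspan (range b) a) -> dual_basis b K.
Proof.
move=> K_lin K_delta b_span; split=> // a.
have [s [bs ->]] := b_span a.
under [RHS]eq_bigr do rewrite (semilin_sum _ _ _ _ (K_lin _)) ascale_suml.
rewrite exchange_big big_seq [RHS]big_seq; apply: eq_bigr => p sp /=.
under eq_bigr do rewrite -ascaleA.
rewrite -ascale_sumr; congr (_ *a _); have [j _ <-] := bs _ sp.
by under eq_bigr do rewrite K_delta; rewrite sum_delta.
Qed.

Lemma basis_span (R : comPzRingType) (A : algebra R) (I : finType)
    (b : I -> A) a : is_basis b -> lspan (range b) a.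
Proof.
move=> b_basis; rewrite (kappa_sum a b_basis); apply: lspan_sum => i _.
by apply/lspanZ/lspan_gen; exists i.
Qed.

Lemma lspan_sub (R : comPzRingType) (A : algebra R) (X Y : set A) :
  (forall x, X x -> lspan Y x) -> forall x, lspan X x -> lspan Y x.
Proof. by apply: (@semilin_lspan _ _ _ _ id id). Qed.

(** * Combining semilinear maps *)

Section SemilinearOperations.
Variables (R R' : comPzRingType) (A : algebra R) (A' : algebra R').
Variable tau : R -> R'.
Let s r := @ascale R' A' (tau r).
Implicit Types h : A -> A'.

Lemma semilinB h h' :
  semilin s h -> semilin s h' -> semilin s (fun x => h x - h' x).
Proof.
move=> [hD hZ] [h'D h'Z]; split=> [x y|r x].
  by rewrite hD h'D opprD addrACA.
by rewrite hZ h'Z /s ascaleBr.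
Qed.

Lemma semilin_sumf (I : Type) (t : seq I) (F : I -> A -> A') :
  (forall i, semilin s (F i)) ->
  semilin s (fun x => \sum_(i <- t) F i x).
Proof.
move=> F_lin; split=> [x y|r x].
  by rewrite -big_split; apply: eq_bigr => i _; rewrite (F_lin i).1.
by rewrite /s ascale_sumr; apply: eq_bigr => i _; rewrite (F_lin i).2.
Qed.

Lemma semilinZ c h : semilin s h -> semilin s (fun x => c *a h x).
Proof.
move=> [hD hZ]; split=> [x y|r x]; first by rewrite hD ascaleDr.
by rewrite hZ /s !ascaleA mulrC.
Qed.

Lemma semilinMl a h : semilin s h -> semilin s (fun x => a * h x).
Proof.
move=> [hD hZ]; split=> [x y|r x]; first by rewrite hD mulrDr.
by rewrite hZ /s ascaleAr.
Qed.

Lemma semilin_compMl a h : semilin s h -> semilin s (fun x => h (a * x)).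
Proof.
move=> [hD hZ]; split=> [x y|r x]; first by rewrite mulrDr hD.
by rewrite ascaleAr hZ.
Qed.

Lemma semilin_comp h (k : A -> A) :
  semilin s h -> is_linear k -> semilin s (h \o k).
Proof.
move=> [hD hZ] /semilin_is_linear[kD kZ].
by split=> [x y|r x] /=; rewrite ?kD ?hD // kZ hZ.
Qed.

Lemma semilin_comp_linear h (k : A' -> A') :
  semilin s h -> is_linear k -> semilin s (k \o h).
Proof.
move=> [hD hZ] /semilin_is_linear[kD kZ].
by split=> [x y|r x] /=; rewrite ?hD ?kD // hZ kZ.
Qed.

End SemilinearOperations.

(** * Tensor products and extension of scalars *)

Lemma int_scale (G : algebra int) (z : int) (g : G) : z *a g = g *~ z.
Proof. by rewrite /ascale -[z in alg_map _ z]intz rmorph_int mulrzl. Qed.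

Lemma tpure_mulz (M N : zmodType) (m : M) (n : N) (z : int) :
  (m *~ z) \ox n = m \ox (n *~ z).
Proof.
rewrite (morphD_mulz (h := fun m => m \ox n)); last first.
  by move=> x y; rewrite tpureDl.
by rewrite (morphD_mulz (h := tpure m)) // => x y; rewrite tpureDr.
Qed.

Lemma tpure_sumr (M N : zmodType) (m : M) (I : Type) (t : seq I) (P : pred I)
    (F : I -> N) :
  m \ox (\sum_(i <- t | P i) F i) = \sum_(i <- t | P i) m \ox F i.
Proof. by rewrite (morphD_sum (h := tpure m)) // => x y; rewrite tpureDr. Qed.

Lemma tens_additive_eq (M N V : zmodType) (h h' : tens M N -> V) :
  {morph h : x y / x + y} -> {morph h' : x y / x + y} ->
  (forall m n, h (m \ox n) = h' (m \ox n)) -> h =1 h'.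
Proof.
move=> hD h'D eq_h t; elim/tens_ind: t => [//|t u IHt IHu].
by rewrite hD h'D IHt IHu.
Qed.

Section TensorMap.
Variables (R M N : zmodType) (h : M -> N).
Hypothesis hD : {morph h : x y / x + y}.

Let h_biadd : biadditive (fun r m => r \ox h m : tens R N).
Proof. by split=> *; rewrite ?hD ?tpureDl ?tpureDr. Qed.

Lemma tens_extE r m : tens_ext h (r \ox m : tens R M) = r \ox h m.
Proof. exact: tens_liftE. Qed.

Lemma tens_extD : {morph tens_ext (R := R) h : x y / x + y}.
Proof. by move=> x y; rewrite /tens_ext tens_liftD. Qed.

End TensorMap.

Section ScalarExtensionBasis.
Variables (R : comPzRingType) (G : algebra int) (I : finType).
Variables (b : I -> G) (K : I -> G -> int).

Definition ext_coord (i : I) : ext_alg R G -> R :=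
  tens_lift (fun r g => r * (K i g)%:~R).

(** The form K_i extends to r (x) g |-> r K_i(g); the factor K_i(g) is an integer,
so it may be moved across the tensor product over Z. *)
Lemma dual_basis_ext :
  dual_basis b K -> dual_basis (fun i => 1 \ox b i : ext_alg R G) ext_coord.
Proof.
case=> K_lin K_sum K_delta.
have biadd i : biadditive (fun (r : R) g => r * (K i g)%:~R).
  by split=> *; rewrite ?mulrDl // (K_lin i).1 intrD mulrDr.
have KD i : {morph ext_coord i : x y / x + y}.
  by move=> x y; rewrite /ext_coord tens_liftD.
have KE i r g : ext_coord i (r \ox g) = r * (K i g)%:~R.
  by rewrite /ext_coord tens_liftE.
split=> [i|a|i j].
- split=> // r; apply: tens_additive_eq => [x y|x y|s g].
  + by rewrite ascaleDr KD.
  + by rewrite KD mulrDr.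
  + by rewrite [r *a _]tpureM mul1r !KE mulrA.
- move: a; apply: (@tens_additive_eq _ _ _ id) => // [x y|r g].
    by rewrite -big_split; apply: eq_bigr => i _; rewrite KD ascaleDl.
  rewrite {1}(K_sum g) tpure_sumr; apply: eq_bigr => i _.
  by rewrite int_scale -tpure_mulz KE /ascale /= tpureM mulr1 mul1r mulrzr.
- by rewrite KE K_delta mul1r; case: (i == j).
Qed.

End ScalarExtensionBasis.

Section TensorAlgebraBasis.
Variables (R S : comPzRingType) (A : algebra S).

Lemma tens_scaleE r s r' (a : A) :
  (r \ox s : tens R S) *a (r' \ox a : tens_alg R A) =
  (r * r') \ox (s *a a).
Proof. by rewrite /ascale /= tens_mapE tpureM. Qed.

(** The two algebra structures on R (x) A, over R and over R (x) S, share the same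
underlying ring; this compares their scalar actions. *)
Lemma ext_tens_scale r (x : ext_alg R A) :
  r *a x = (r \ox 1 : tens R S) *a (x : tens_alg R A).
Proof. by rewrite /ascale /= tens_mapE rmorph1. Qed.

Lemma tens_ext_semilin (h : A -> A) :
  semilin (@ascale S A) h ->
  semilin (@ascale (tens R S) (tens_alg R A))
    (tens_ext h : tens_alg R A -> tens_alg R A).
Proof.
case=> hD hZ; have hTD := tens_extD (R := R) hD.
split=> // r x; move: r; apply: tens_additive_eq => [r r'|r r'|r s].
- by rewrite ascaleDl hTD.
- by rewrite ascaleDl.
move: x; apply: tens_additive_eq => [x y|x y|r' a].
- by rewrite ascaleDr hTD.
- by rewrite hTD ascaleDr.
by rewrite tens_scaleE !tens_extE // tens_scaleE hZ.
Qed.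

Variables (I : finType) (b : I -> A) (K : I -> A -> S).

Lemma dual_basis_tens :
  dual_basis b K ->
  dual_basis (fun i => 1 \ox b i : tens_alg R A) (fun i => tens_ext (K i)).
Proof.
case=> K_lin K_sum K_delta.
have KD i := tens_extD (R := R) (K_lin i).1.
have KE i := tens_extE (R := R) (K_lin i).1.
split=> [i|a|i j].
- split=> // r x; move: r; apply: tens_additive_eq => [r r'|r r'|r s].
  + by rewrite ascaleDl KD.
  + by rewrite mulrDl.
  move: x; apply: tens_additive_eq => [x y|x y|r' a].
  + by rewrite ascaleDr KD.
  + by rewrite KD mulrDr.
  by rewrite tens_scaleE !KE tpureM (K_lin i).2.
- move: a; apply: (@tens_additive_eq _ _ _ id) => // [x y|r a].
    by rewrite -big_split; apply: eq_bigr => i _; rewrite KD ascaleDl.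
  rewrite {1}(K_sum a) tpure_sumr; apply: eq_bigr => i _.
  by rewrite KE tens_scaleE mulr1.
- by rewrite KE K_delta; case: (i == j) => //; rewrite tpure0r.
Qed.

End TensorAlgebraBasis.

(** * The specialization v = 1 *)

Lemma laurent_eval_wd (p q : {poly int}) m n :
  tofrac p / tofrac 'X^m = tofrac q / tofrac 'X^n -> p.[1] = q.[1].
Proof.
have X0 k : tofrac ('X^k : {poly int}) != 0.
  by rewrite tofrac_eq0 expf_neq0 // polyX_eq0.
move/eqP; rewrite eqr_div // -!rmorphM /= tofrac_eq => /eqP.
move/(congr1 (horner^~ 1)).
by rewrite !hornerE !expr1n !mulr1.
Qed.

Fact laurentP (x : laurent) : exists pn : ({poly int} * nat)%type,
  laurent_val x == tofrac pn.1 / tofrac 'X^(pn.2).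
Proof. by case: x => x /= /asboolP[p [n ->]]; exists (p, n). Qed.

(** The value does not depend on the chosen fraction p / v^n, since the powers of
v become 1. *)
Definition laurent_eval1 (x : laurent) : int := (xchoose (laurentP x)).1.[1].

Lemma laurent_eval1E x p n :
  laurent_val x = tofrac p / tofrac 'X^n -> laurent_eval1 x = p.[1].
Proof.
by rewrite (eqP (xchooseP (laurentP x))) => /laurent_eval_wd.
Qed.

Lemma laurent_eval1D : {morph laurent_eval1 : x y / x + y}.
Proof.
have X0 k : tofrac ('X^k : {poly int}) != 0.
  by rewrite tofrac_eq0 expf_neq0 // polyX_eq0.
move=> x y; have [[p n] /eqP Ex] := laurentP x.
have [[q m] /eqP Ey] := laurentP y.
rewrite (laurent_eval1E Ex) (laurent_eval1E Ey).
rewrite (@laurent_eval1E (x + y) (p * 'X^m + q * 'X^n) (n + m)).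
  by rewrite !hornerE !expr1n !mulr1.
have -> : laurent_val (x + y) = laurent_val x + laurent_val y.
  exact: (rmorphD (\val : laurent -> {fraction {poly int}})).
by rewrite Ex Ey addf_div // exprD rmorphD !rmorphM.
Qed.

Lemma laurent_eval1_1 : laurent_eval1 1 = 1.
Proof.
rewrite (@laurent_eval1E 1 1 0); first by rewrite hornerE.
rewrite [LHS](rmorph1 (\val : laurent -> {fraction {poly int}})).
by rewrite expr0 rmorph1 divr1.
Qed.

(** The additive map r (x) p |-> r p(1) sends 1 to 1, which is nonzero in R. *)
Lemma tens_laurent_neq0 (R : comNzRingType) : (1 : tens R laurent) != 0.
Proof.
pose ev (r : R) (p : laurent) := r * (laurent_eval1 p)%:~R.
have ev_biadd : biadditive ev.
  by split=> *; rewrite /ev ?mulrDl // laurent_eval1D intrD mulrDr.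
apply/eqP => /(congr1 (tens_lift ev)).
rewrite tens_lift0 // [1]/(1 \ox 1) tens_liftE //.
by rewrite /ev laurent_eval1_1 mulr1 => /eqP; rewrite oner_eq0.
Qed.

(** * Automorphisms of hypergroups *)

Section HypergroupAutomorphism.
Variables (G : algebra int) (I : finType) (b : I -> G) (bar f : G -> G).
Hypotheses (b_hyp : hypergroup b bar) (f_aut : based_automorphism b f).

Let b_basis : is_basis b := based_basis (hyp_based b_hyp).

Lemma hypergroup_bar_index i : exists j, bar (b i) = b j.
Proof.
have : (bar @` range b) (bar (b i)) by exists (b i) => //; exists i.
by rewrite (hyp_bar_range b_hyp) => -[j _ <-]; exists j.
Qed.

Lemma based_aut_index i : exists j, f (b i) = b j.
Proof.
have : (f @` range b) (f (b i)) by exists (b i) => //; exists i.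
by rewrite (baut_range f_aut) => -[j _ <-]; exists j.
Qed.

Lemma kappa_basis i j : kappa b i (b j) = (i == j)%:R.
Proof. by case: (kappa_dual b_basis). Qed.

Lemma based_aut_semilin : semilin (fun z g => g *~ z) f.
Proof.
have f0 : f 0 = 0 by rewrite -[X in f X](subrr 0) (baut_zmod f_aut) subrr.
have fD : {morph f : x y / x + y}.
  move=> x y; have fN z : f (- z) = - f z.
    by rewrite -sub0r (baut_zmod f_aut) f0 sub0r.
  by rewrite -[y in LHS]opprK (baut_zmod f_aut) fN opprK.
by split=> // z g; rewrite int_scale morphD_mulz.
Qed.

(** An automorphism permutes the basis and fixes the element 1, so it preserves the
coefficient of 1. *)
Lemma kappa_one_aut e g : b e = 1 -> kappa b e (f g) = kappa b e g.
Proof.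
move=> be; have [_ f1] := baut_monoid f_aut.
have kD : semilin (@GRing.mul int) (kappa b e) by case: (kappa_dual b_basis).
have [fD fZ] := based_aut_semilin.
suff: kappa b e \o f =1 kappa b e by apply.
apply: (semilin_basis_eq (s := @GRing.mul int) b_basis) => //.
  split=> [x y|r x] /=; first by rewrite fD kD.1.
  by rewrite fZ -int_scale kD.2.
move=> i /=; have [j fj] := based_aut_index i.
rewrite fj !kappa_basis; congr (nat_of_bool _)%:R; apply/eqP/eqP => [ej|ei].
  apply: (based_inj (hyp_based b_hyp)); apply: (bij_inj (baut_bij f_aut)).
  by rewrite fj -ej be; case: (baut_monoid f_aut).
apply: (based_inj (hyp_based b_hyp)).
by rewrite -fj -ei be; case: (baut_monoid f_aut).
Qed.

(** By the symmetry [hyp_kappa], the coefficient of 1 in b_j b_i is that of b_j in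
bar b_i.  Taking b_j = bar b_i, this coefficient is 1, and f preserves it, so
that f b_j occurs in the basis element bar (f b_i). *)
Lemma based_aut_bar i : f (bar (b i)) = bar (f (b i)).
Proof.
have [e _ be] := hyp_one b_hyp.
have [j bar_i] := hypergroup_bar_index i; have [k f_j] := based_aut_index j.
have [m f_i] := based_aut_index i; have [n bar_m] := hypergroup_bar_index m.
have fM : {morph f : x y / x * y} by case: (baut_monoid f_aut).
have : kappa b e (f (b j * b i)) = 1.
  rewrite kappa_one_aut // (hyp_kappa b_hyp) be mul1r bar_i.
  by rewrite kappa_basis eqxx.
rewrite fM f_j f_i (hyp_kappa b_hyp) be mul1r bar_m kappa_basis.
by rewrite bar_i f_j; case: eqP => [->|].
Qed.

End HypergroupAutomorphism.

Lemma additive_basis_eq (G : algebra int) (I : finType) (b : I -> G)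
    (V : zmodType) (h h' : G -> V) :
  is_basis b -> {morph h : x y / x + y} -> {morph h' : x y / x + y} ->
  (forall i, h (b i) = h' (b i)) -> h =1 h'.
Proof.
move=> b_basis hD h'D; apply: (semilin_basis_eq (s := fun z x => x *~ z)) => //.
  by split=> // z g; rewrite int_scale morphD_mulz.
by split=> // z g; rewrite int_scale morphD_mulz.
Qed.

(** * The maps g |-> C_{S,T}^g after extension of scalars *)

Section TabularExtension.
Variables (A : algebra laurent) (d : Order.disp_t) (L : finPOrderType d).
Variables (G : L -> algebra int) (B : L -> finType) (b : forall l, B l -> G l).
Variables (M : L -> finType) (C : forall l, M l -> B l -> M l -> A).
Arguments b : clear implicits.
Arguments C : clear implicits.
Hypothesis b_basis : forall l, is_basis (b l).
Hypothesis C_basis : is_basis (tab_fun C).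

Lemma ext_is_basis (R : comPzRingType) l :
  is_basis (fun i => 1 \ox b l i : ext_alg R (G l)).
Proof. apply: dual_is_basis; apply: dual_basis_ext; exact: kappa_dual. Qed.

Lemma tab_ext_basis l (S T : M l) i : tab_ext b C S T (1 \ox b l i) = C l S i T.
Proof. by rewrite /tab_ext (lin_ext_basis _ _ (@ext_is_basis laurent l)). Qed.

Lemma tab_ext_semilin l (S T : M l) :
  semilin (@ascale laurent A) (tab_ext b C S T).
Proof. exact: lin_ext_semilin (@ext_is_basis laurent l). Qed.

Variable R : comNzRingType.
Local Notation RA := (tens_alg R A).
Local Notation phi :=
  (tab_extR b C : forall l, _ -> _ -> ext_alg R (G l) -> RA).

Let inR (r : R) : tens R laurent := r \ox 1.
Let inRs r := @ascale (tens R laurent) RA (inR r).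

Lemma tab_extR_semilin l (S T : M l) : semilin inRs (phi l S T).
Proof.
have [phiD phiZ] := lin_ext_semilin
  (fun i => 1 \ox C l S i T : ext_alg R A) (@ext_is_basis R l).
split=> [x y|r x]; first exact: phiD.
by rewrite /inRs -ext_tens_scale -phiZ.
Qed.

Lemma tab_extR_basis l (S T : M l) i :
  phi l S T (1 \ox b l i) = 1 \ox C l S i T.
Proof. by rewrite /tab_extR (lin_ext_basis _ _ (@ext_is_basis R l)). Qed.

Lemma tab_extR_tpure l (S T : M l) (g : G l) :
  phi l S T (1 \ox g) = 1 \ox tab_ext b C S T (1 \ox g).
Proof.
suff: phi l S T \o tpure 1 =1 tpure 1 \o tab_ext b C S T \o tpure 1 by apply.
apply: (additive_basis_eq (@b_basis l)) => [x y|x y|i] /=.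
- by rewrite tpureDr (tab_extR_semilin S T).1.
- by rewrite tpureDr (tab_ext_semilin S T).1 tpureDr.
- by rewrite tab_extR_basis tab_ext_basis.
Qed.

Local Notation tabI S i T :=
  (Tagged (fun l => (M l * B l * M l)%type) (S, i, T)).
Local Notation tabM S T := (Tagged (fun l => (M l * M l)%type) (S, T)).

Lemma tab_extR_coord l (S T : M l) m (U V : M m) (i : B l) g :
  tens_ext (kappa (tab_fun C) (tabI S i T)) (phi m U V g : RA) =
  \sum_j inR (kappa (fun j => 1 \ox b m j : ext_alg R (G m)) j g) *
     (tabI S i T == tabI U j V)%:R.
Proof.
have [K_lin _ K_delta] := dual_basis_tens R (kappa_dual C_basis).
rewrite {1}(kappa_sum g (@ext_is_basis R m)).
rewrite (semilin_sum _ _ _ _ (tab_extR_semilin U V)).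
rewrite (semilin_sum _ _ _ _ (K_lin _)); apply: eq_bigr => j _; congr (_ * _).
by rewrite tab_extR_basis -K_delta.
Qed.

(** * The cell basis *)

Variables (d' : Order.disp_t) (L' : L -> finPOrderType d').
Variables (N : forall l, L' l -> finType).
Arguments N : clear implicits.
Variables (D : forall l (l' : L' l), N l l' -> N l l' -> ext_alg R (G l)).
Variable (sigma : forall l, {perm M l}).
Arguments D : clear implicits.
Arguments sigma : clear implicits.
Hypothesis D_basis : forall l, is_basis (cell_fun (D l)).

Definition tab_cell (x : {l : L & L' l})
    (S T : (M (tag x) * N _ (tagged x))%type) : RA :=
  phi (tag x) S.1 (sigma (tag x) T.1) (D (tag x) (tagged x) S.2 T.2).

Local Notation cellN l := {l' : L' l & (N l l' * N l l')%type}.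
Local Notation cellM :=
  {x : {l : L & L' l} & ((M (tag x) * N _ (tagged x)) *
                         (M (tag x) * N _ (tagged x)))%type}.

Let cell_index l (S T : M l) (y : cellN l) : cellM :=
  existT (fun x : {l : L & L' l} => ((M (tag x) * N _ (tagged x)) *
                                     (M (tag x) * N _ (tagged x)))%type)
    (Tagged L' (tag y)) ((S, (tagged y).1), (T, (tagged y).2)).

(** Since D spans R (x) G l, membership of all C_{S,T}^g in a span need only be
checked for g in D. *)
Lemma tab_extR_lspan X l (S T : M l) g :
  (forall l' s t, lspan X (phi l S T (D l l' s t))) -> lspan X (phi l S T g).
Proof.
move=> X_D; move: (basis_span g (@D_basis l)).
apply: semilin_lspan (tab_extR_semilin S T) _ _ => _ [[l' [s t]] _ <-].
exact: X_D.
Qed.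

Let D_index (z : cellM) : cellN (tag (tag z)) :=
  Tagged (fun l' => (N _ l' * N _ l')%type) ((tagged z).1.2, (tagged z).2.2).

(* The dual form at the index ((S,s),(T,t)): the (S, sigma T)-components of a form
an element of R (x) G l with scalars extended, and its coordinate on D(s,t) is
obtained from its coordinates on the b_i by the change of basis from b to D. *)
Let coord (z : cellM) (a : RA) : tens R laurent :=
  \sum_i inR (kappa (cell_fun (D (tag (tag z)))) (D_index z) (1 \ox b _ i)) *
    tens_ext (kappa (tab_fun C)
      (tabI (tagged z).1.1 i (sigma _ (tagged z).2.1))) a.

Let inRD : {morph inR : x y / x + y}.
Proof. by move=> x y; rewrite /inR tpureDl. Qed.

Let inRM : {morph inR : x y / x * y}.
Proof. by move=> x y; rewrite /inR tpureM mulr1. Qed.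

Let coord_semilin z : semilin (@GRing.mul (tens R laurent)) (coord z).
Proof.
have [K_lin _ _] := dual_basis_tens R (kappa_dual C_basis).
split=> [x y|r x].
  by rewrite -big_split; apply: eq_bigr => i _; rewrite (K_lin _).1 mulrDr.
by rewrite mulr_sumr; apply: eq_bigr => i _; rewrite (K_lin _).2 mulrCA.
Qed.

Let coord_extR_eq z g :
  coord z (phi (tag (tag z)) (tagged z).1.1 (sigma _ (tagged z).2.1) g) =
  inR (kappa (cell_fun (D (tag (tag z)))) (D_index z) g).
Proof.
have [K_lin _ _] := kappa_dual (@D_basis (tag (tag z))).
rewrite [in RHS](kappa_sum g (@ext_is_basis R _)).
rewrite (semilin_sum _ _ _ _ (K_lin _)) (morphD_sum _ _ _ inRD).
apply: eq_bigr => i _; rewrite tab_extR_coord (bigD1 i) //= eqxx mulr1.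
rewrite big1 ?addr0 => [|j /negPf ji]; first by rewrite mulrC -inRM.
by rewrite eq_Tagged /= !xpair_eqE eq_sym ji andbF mulr0.
Qed.

Let coord_extR_neq z m (U V : M m) g :
  tabM (tagged z).1.1 (sigma _ (tagged z).2.1) != tabM U V ->
  coord z (phi m U V g) = 0.
Proof.
move=> neq; rewrite /coord big1 // => i _.
rewrite tab_extR_coord big1 ?mulr0 // => j _.
case: eqP => [/(congr1 (fun y : {l & (M l * B l * M l)%type} =>
  tabM (tagged y).1.1 (tagged y).2))|].
  by move/eqP; rewrite (negPf neq).
by rewrite mulr0.
Qed.

(* Stated in the total space because the type of D_index z depends on z. *)
Let D_index_congr z z' : z = z' ->
  Tagged (fun l => cellN l) (D_index z) = Tagged (fun l => cellN l) (D_index z').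
Proof. by move->. Qed.

Lemma tab_cell_is_basis : is_basis (cell_fun tab_cell : cellM -> RA).
Proof.
apply: dual_is_basis; apply: (dual_basis_of_span coord_semilin) => [z z'|a].
  have [_ _ K_delta] := kappa_dual (@D_basis (tag (tag z))).
  rewrite /cell_fun /tab_cell.
  case: (eqVneq (tabM (tagged z).1.1 (sigma _ (tagged z).2.1))
                (tabM (tagged z').1.1 (sigma _ (tagged z').2.1))) => [eqM|neqM].
    case: z z' K_delta eqM => -[l l'] /= [[S s] [T t]] [[m m'] /= [[U u] [V v]]].
    move=> K_delta eqM; have lm : l = m := congr1 tag eqM.
    case: _ / lm in m' U V u v eqM *.
    case: (eq_from_Tagged eqM) => -> /perm_inj ->.
    (* Both indices now lie over the same S and T. *)
    set z := existT _ _ _; set z' := existT _ _ _.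
    transitivity (inR ((D_index z == D_index z')%:R)); last first.
      have -> : (D_index z == D_index z') = (z == z').
        apply/eqP/eqP => zz'; last exact: eq_from_Tagged (D_index_congr zz').
        exact: (congr1 (fun y : cellN l => cell_index U V y) zz').
      by case: (z == z') => //; rewrite /inR tpure0l.
    rewrite -K_delta.
    exact: (@coord_extR_eq z).
  rewrite coord_extR_neq //; case: eqP => // zz'.
  by move: neqM; rewrite zz' eqxx.
have C_span :=
  basis_span a (dual_is_basis (dual_basis_tens R (kappa_dual C_basis))).
apply: lspan_sub C_span => _ [[l [[S i] T]] _ <-].
rewrite /tab_fun /= -tab_extR_basis.
apply: tab_extR_lspan => l' s t; apply: lspan_gen.
exists (cell_index S ((sigma l)^-1%g T)
          (Tagged (fun l' => (N l l' * N l l')%type) (s, t))) => //.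
by rewrite /cell_fun /tab_cell /= permKV.
Qed.

(** * Multiplication of the cell basis *)

(** The difference is semilinear in x, and at x = 1 (x) b_i it is the extension of
the error term of the tabular multiplication rule for g = b_i. *)
Lemma tab_mul_extR l (a : A) (r : M l -> M l -> ext_alg laurent (G l)) :
  (forall (g : G l) (S T : M l),
     tab_below C l (a * tab_ext b C S T (1 \ox g)
       - \sum_(S' : M l) tab_ext b C S' T (r S' S * (1 \ox g)))) ->
  forall (S T : M l) (x : ext_alg R (G l)),
    lspan [set y : RA | exists m U V g, (m < l)%O /\ y = phi m U V g]
      ((1 \ox a : RA) * phi l S T x -
       \sum_(S' : M l) \sum_k
         (1 \ox kappa (fun i => 1 \ox b l i : ext_alg laurent (G l)) k (r S' S)
            : tens R laurent) *a phi l S' T ((1 \ox b l k) * x)).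
Proof.
move=> ar S T x; set X := (X in lspan X _).
pose c S' k := kappa (fun i => 1 \ox b l i : ext_alg laurent (G l)) k (r S' S).
have h_lin : semilin inRs (fun x => (1 \ox a : RA) * phi l S T x -
    \sum_(S' : M l) \sum_k
      (1 \ox c S' k : tens R laurent) *a phi l S' T ((1 \ox b l k) * x)).
  have phi_lin := tab_extR_semilin.
  apply: semilinB; first exact/semilinMl/phi_lin.
  apply: semilin_sumf => S'; apply: semilin_sumf => k; apply: semilinZ.
  exact/semilin_compMl/phi_lin.
apply: (semilin_lspan h_lin) (basis_span x (@ext_is_basis R l)) => _ [i _ <-].
have -> : (1 \ox a : RA) * phi l S T (1 \ox b l i) -
    \sum_(S' : M l) \sum_k (1 \ox c S' k : tens R laurent) *a
      phi l S' T ((1 \ox b l k) * (1 \ox b l i)) =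
    1 \ox (a * tab_ext b C S T (1 \ox b l i)
       - \sum_(S' : M l) tab_ext b C S' T (r S' S * (1 \ox b l i))).
  have tD : {morph (fun a => 1 \ox a : RA) : u v / u + v}.
    by move=> u v; rewrite tpureDr.
  rewrite (morphDB tD); congr (_ - _).
    by rewrite tab_extR_tpure tpureM mul1r.
  rewrite (morphD_sum _ _ _ tD); apply: eq_bigr => S' _.
  rewrite (kappa_sum (r S' S) (@ext_is_basis laurent l)) mulr_suml.
  under [in RHS]eq_bigr do rewrite ascaleAl.
  rewrite (semilin_sum _ _ _ _ (tab_ext_semilin S' T)) (morphD_sum _ _ _ tD).
  apply: eq_bigr => k _.
  by rewrite !tpureM !mul1r tab_extR_tpure tens_scaleE mulr1.
have tens_lin : semilin (fun p => @ascale _ RA (1 \ox p)) (fun a => 1 \ox a).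
  by split=> [u v|p u]; rewrite ?tpureDr // tens_scaleE mulr1.
apply: (semilin_lspan tens_lin) (ar (b l i) S T) => _ [m [U [j [V [ml ->]]]]].
by apply: lspan_gen; exists m, U, V, (1 \ox b m j); rewrite tab_extR_basis.
Qed.

Lemma tab_cell_mul :
  (forall l (a : A), exists r : M l -> M l -> ext_alg laurent (G l),
     forall (g : G l) (S T : M l),
       tab_below C l (a * tab_ext b C S T (1 \ox g)
         - \sum_(S' : M l) tab_ext b C S' T (r S' S * (1 \ox g)))) ->
  (forall l (l' : L' l) (g : ext_alg R (G l)),
     exists r : N l l' -> N l l' -> R, forall s t : N l l',
       cell_below (D l) l'
         (g * D l l' s t - \sum_(s' : N l l') r s' s *a D l l' s' t)) ->
  forall x (a : RA), exists r, forall S T,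
    cell_below tab_cell x
      (a * tab_cell S T - \sum_S' r S' S *a tab_cell (x := x) S' T).
Proof.
move=> A_mul D_mul [l l'] a; rewrite /cell_below; set x := existT _ l l'.
set X := [set y : RA | exists m S T, (m < x)%O /\ y = tab_cell (x := m) S T].
rewrite -/X.
(* Elements over m < l lie below (l,l'), whatever their second index. *)
have X_lower m (U V : M m) g : (m < l)%O -> lspan X (phi m U V g).
  move=> ml; apply: tab_extR_lspan => m' s t; apply: lspan_gen.
  exists (Tagged L' m'), (U, s), ((sigma m)^-1%g V, t).
  rewrite /tab_cell /= permKV; split=> //.
  by rewrite ltEsig /= (ltW ml) (lt_geF ml).
(* Over l itself, the order on L' l decides. *)
have X_same (U V : M l) g : cell_below (D l) l' g -> lspan X (phi l U V g).
  apply: semilin_lspan (tab_extR_semilin U V) _ _ => _ [m' [s [t [ml ->]]]].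
  apply: lspan_gen; exists (Tagged L' m'), (U, s), ((sigma l)^-1%g V, t).
  by rewrite /tab_cell /= permKV lt_Taggedr.
elim/tens_ind: a => [p a|a a' [r Xr] [r' Xr']]; last first.
  exists (fun S' S => r S' S + r' S' S) => S T.
  under eq_bigr do rewrite ascaleDl.
  by rewrite mulrDl big_split opprD addrACA; apply: lspanD.
have [rA A_r] := A_mul l a.
have [rD D_r] := choice (fun k => D_mul l l' (1 \ox b l k)).
pose c S' S k := kappa (fun i => 1 \ox b l i : ext_alg laurent (G l)) k (rA S' S).
exists (fun S' S => \sum_k (p * rD k S'.2 S.2) \ox c S'.1 S.1 k).
move=> [S s] [T t].
(* The difference is p times the error of the tabular rule for a, plus multiples
   of the errors of the cell rule for the products of b_k with D(s,t). *)
have -> : (p \ox a : RA) * tab_cell (x := x) (S, s) (T, t) -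
    \sum_S' (\sum_k (p * rD k S'.2 s) \ox c S'.1 S k : tens R laurent) *a
      tab_cell (x := x) S' (T, t) =
  inR p *a (((1 \ox a : RA) * phi l S (sigma l T) (D l l' s t) -
    \sum_(S' : M l) \sum_k (1 \ox c S' S k : tens R laurent) *a
      phi l S' (sigma l T) ((1 \ox b l k) * D l l' s t)) +
    \sum_(S' : M l) \sum_k (1 \ox c S' S k : tens R laurent) *a
      phi l S' (sigma l T) ((1 \ox b l k) * D l l' s t -
        \sum_(s' : N l l') rD k s' s *a D l l' s' t)).
  under [X in _ *a (_ + X)]eq_bigr => S' _.
    under eq_bigr => k _.
      rewrite (morphDB (tab_extR_semilin S' (sigma l T)).1) ascaleBr.
      rewrite (semilin_sum _ _ _ _ (tab_extR_semilin S' (sigma l T))).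
      over.
    rewrite sumrB; over.
  rewrite sumrB addrA subrK ascaleBr; congr (_ - _).
    by rewrite -ascaleAl tens_scaleE mulr1 ascale1.
  rewrite -(pair_bigA _ (fun S' s' =>
    (\sum_k (p * rD k s' s) \ox c S' S k : tens R laurent) *a
      tab_cell (x := x) (S', s') (T, t))) ascale_sumr /=.
  apply: eq_bigr => S' _; under eq_bigr do rewrite ascale_suml.
  rewrite exchange_big ascale_sumr; apply: eq_bigr => k _.
  rewrite !ascale_sumr; apply: eq_bigr => s' _.
  by rewrite /inRs !ascaleA /inR !tpureM !mul1r !mulr1.
apply: lspanZ; apply: lspanD.
  apply: lspan_sub (tab_mul_extR A_r S (sigma l T) (D l l' s t)).
  by move=> _ [m [U [V [g [ml ->]]]]]; apply: X_lower.
apply: lspan_sum => S' _; apply: lspan_sum => k _; apply: lspanZ.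
exact/X_same/D_r.
Qed.
End TabularExtension.

(** * The twisted involution *)

Section TwistedInvolution.
Variables (A : algebra laurent) (d : Order.disp_t) (L : finPOrderType d).
Variables (G : L -> algebra int) (B : L -> finType) (b : forall l, B l -> G l).
Variables (bar : forall l, G l -> G l) (M : L -> finType).
Variables (C : forall l, M l -> B l -> M l -> A) (star : A -> A).
Arguments b : clear implicits.
Arguments bar : clear implicits.
Arguments C : clear implicits.
Hypothesis A_tabular : tabular b bar C star.
Variables (alpha : A -> A) (sigma : forall l, {perm M l}).
Variable (f : forall l, G l -> G l).
Arguments sigma : clear implicits.
Arguments f : clear implicits.
Hypotheses (alpha_aut : alg_automorphism alpha).
Hypothesis alpha_star : involutive (alpha \o star).
Hypothesis f_aut : forall l, based_automorphism (b l) (f l).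
Hypothesis alphaE : forall l (S T : M l) (i : B l),
  alpha (C l S i T) =
  tab_ext b C (sigma l S) (sigma l T) (1 \ox f l (b l i)).

Lemma tabular_hyp_basis l : is_basis (b l).
Proof. exact: based_basis (hyp_based (tab_hyp A_tabular l)). Qed.

Let tabE := tab_ext_basis C tabular_hyp_basis.

Let star_lin : is_linear star. Proof. by case: (tab_star A_tabular). Qed.
Let alpha_lin : is_linear alpha. Proof. by case: alpha_aut. Qed.

Lemma star_alpha_basis l (S T : M l) i :
  star (alpha (C l S i T)) =
    tab_ext b C (sigma l T) (sigma l S) (1 \ox bar l (f l (b l i))).
Proof.
have [j f_i] := based_aut_index (f_aut l) i.
by rewrite alphaE f_i tabE (tab_starE A_tabular).
Qed.

(** On C_{S,T}^i both sides have outer indices sigma T and sigma S, and their middle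
entries bar (f b_i) and f (bar b_i) agree. *)
Lemma star_alphaC a : star (alpha a) = alpha (star a).
Proof.
suff: star \o alpha =1 alpha \o star by apply.
apply: (semilin_basis_eq (s := @ascale laurent A) (tab_basis A_tabular)).
- apply/semilin_is_linear => r x y /=.
  by rewrite alpha_lin star_lin.
- apply/semilin_is_linear => r x y /=.
  by rewrite star_lin alpha_lin.
case=> l [[S i] T]; rewrite /tab_fun /= star_alpha_basis.
have [j bar_i] := hypergroup_bar_index (tab_hyp A_tabular l) i.
rewrite (tab_starE A_tabular) bar_i tabE alphaE -bar_i.
by rewrite (based_aut_bar (tab_hyp A_tabular l) (f_aut l)).
Qed.

(** As the two commute, the square of their composite is alpha^2. *)
Lemma alpha_involutive : involutive alpha.
Proof.
have star2 : involutive star by case: (tab_star A_tabular).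
by move=> a; rewrite -[RHS]alpha_star /= star_alphaC star2.
Qed.

(** The identity alpha^2 maps C_{S,S}^i to an element with outer indices
sigma (sigma S), and the hypergroup basis is nonempty, so such an i exists. *)
Lemma sigma_involutive l : involutive (sigma l).
Proof.
move=> S; have [i _ _] := hyp_one (tab_hyp A_tabular l).
have := alpha_involutive (C l S i S); rewrite alphaE.
have [j ->] := based_aut_index (f_aut l) i; rewrite tabE alphaE.
have [k ->] := based_aut_index (f_aut l) j; rewrite tabE.
pose idx (U : M l) (n : B l) :=
  Tagged (fun l => (M l * B l * M l)%type) (U, n, U).
move=> CC.
have {}CC : tab_fun C (idx (sigma l (sigma l S)) k) = tab_fun C (idx S i).
  exact: CC.
by case: (eq_from_Tagged (tab_inj A_tabular CC)).
Qed.

Variable R : comNzRingType.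
Local Notation RA := (tens_alg R A).
Let star' := (tens_ext (star \o alpha) : RA -> RA).

Let sa_semilin : semilin (@ascale laurent A) (star \o alpha).
Proof.
by apply/semilin_is_linear => r x y /=; rewrite alpha_lin star_lin.
Qed.

Lemma tens_star_basis l (S T : M l) i :
  star' (1 \ox C l S i T) =
    tab_extR b C (sigma l T) (sigma l S)
      (tens_ext (bar l \o f l) (1 \ox b l i)).
Proof.
have [fD _] := based_aut_semilin (f_aut l).
have [bar_lin _ _] := hyp_bar (tab_hyp A_tabular l).
have /semilin_is_linear[barD _] := bar_lin.
rewrite /star' (tens_extE sa_semilin.1) /= star_alpha_basis tens_extE /=.
  by rewrite tab_extR_tpure //; [exact: tabular_hyp_basis].
by move=> x y /=; rewrite fD barD.
Qed.

Lemma tens_star_anti_involution : anti_involution star'.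
Proof.
have star'_lin : semilin _ star' := tens_ext_semilin R sa_semilin.
have [star'D _] := star'_lin.
have star'E r a : star' (r \ox a) = r \ox (star (alpha a)).
  exact: tens_extE sa_semilin.1 r a.
have [_ starM starK] := tab_star A_tabular.
have [_ [_ alphaM] _] := alpha_aut.
split.
- exact/semilin_is_linear.
- move=> x y; move: x; apply: tens_additive_eq => [u v|u v|r a].
  + by rewrite mulrDl star'D.
  + by rewrite star'D mulrDr.
  move: y; apply: tens_additive_eq => [u v|u v|s c].
  + by rewrite mulrDr star'D.
  + by rewrite star'D mulrDl.
  by rewrite !tpureM !star'E tpureM alphaM starM mulrC.
- apply: (@tens_additive_eq _ _ _ (star' \o star') id) => // [u v|r a] /=.
    by rewrite !star'D.
  by rewrite !star'E star_alphaC starK alpha_involutive.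
Qed.

(** Both sides are semilinear in g along r |-> r (x) 1, so the case of a basis
element suffices. *)
Lemma tens_star_extR l (S T : M l) g :
  is_linear (tens_ext (bar l \o f l) : ext_alg R (G l) -> ext_alg R (G l)) ->
  star' (tab_extR b C S T g) =
    tab_extR b C (sigma l T) (sigma l S) (tens_ext (bar l \o f l) g).
Proof.
move=> barf_lin; have [star'_lin _ _] := tens_star_anti_involution.
have phi_lin := tab_extR_semilin C tabular_hyp_basis R.
suff: star' \o tab_extR b C S T =1
    tab_extR b C (sigma l T) (sigma l S) \o tens_ext (bar l \o f l) by apply.
apply: semilin_basis_eq (@ext_is_basis _ _ _ _ _ tabular_hyp_basis R l) _ _ _.
- exact: semilin_comp_linear (phi_lin _ S T) star'_lin.
- exact: semilin_comp (phi_lin _ _ _) barf_lin.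
move=> i /=; rewrite tab_extR_basis; first exact: tens_star_basis.
exact: tabular_hyp_basis.
Qed.

End TwistedInvolution.

(** * Cellularity *)

Theorem theorem2p2p1
  (* a tabular algebra of finite rank *)
  (A : algebra laurent) (d : Order.disp_t) (L : finPOrderType d)
  (G : L -> algebra int) (B : L -> finType) (b : forall l, B l -> G l)
  (bar : forall l, G l -> G l) (M : L -> finType)
  (C : forall l, M l -> B l -> M l -> A) (star : A -> A)
  (A_tabular : tabular b bar C star)
  (* the ring of coefficients *)
  (R : comNzRingType) (Z_sub_R : injective (fun z : int => z%:~R : R))
  (* the automorphism *)
  (alpha : A -> A) (alpha_aut : alg_automorphism alpha)
  (alpha_range : alpha @` range (tab_fun C) = range (tab_fun C))
  (alpha_star : involutive (alpha \o star))
  (sigma : forall l, {perm M l}) (f : forall l, G l -> G l)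
  (f_aut : forall l, based_automorphism (b l) (f l))
  (alphaE : forall l (S T : M l) (i : B l),
     alpha (C l S i T) =
     tab_ext b C (sigma l S) (sigma l T) (1 \ox f l (b l i)))
  (* the cell data of the R (x) G l *)
  (d' : Order.disp_t) (L' : L -> finPOrderType d')
  (N : forall l, L' l -> finType)
  (D : forall l (l' : L' l), N l l' -> N l l' -> ext_alg R (G l))
  (G_cellular : forall l,
     @cellular R (ext_alg R (G l)) d' (L' l) (N l) (D l)
       (tens_ext (bar l \o f l))) :
  [/\ forall a, star (alpha a) = alpha (star a),
      forall l (S T : M l) (i : B l),
        tens_ext (star \o alpha) (1 \ox C l S i T : tens R A) =
        tab_extR b C (sigma l T) (sigma l S)
          (tens_ext (bar l \o f l) (1 \ox b l i))
    & @cellular (tens R laurent) (tens_alg R A) d' {l : L & L' l}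
        (fun x => (M (tag x) * N (tag x) (tagged x))%type : finType)
        (fun x S T =>
           tab_extR b C S.1 (sigma (tag x) T.1)
             (D (tag x) (tagged x) S.2 T.2))
        (tens_ext (star \o alpha))].
Proof.
have b_basis := tabular_hyp_basis A_tabular.
have C_basis := tab_basis A_tabular.
have D_basis l := cell_basis (G_cellular l).
have barf_lin l : is_linear (tens_ext (bar l \o f l)
    : ext_alg R (G l) -> ext_alg R (G l)).
  by case: (cell_star (G_cellular l)).
have R_basis := tab_cell_is_basis b_basis C_basis sigma D_basis.
split.
- exact: (star_alphaC (sigma := sigma) A_tabular alpha_aut f_aut alphaE).
- exact: (tens_star_basis (sigma := sigma) A_tabular alpha_aut f_aut alphaE R).
split.
- exact: dual_inj (tens_laurent_neq0 R) (kappa_dual R_basis).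
- exact: R_basis.
- exact: (tens_star_anti_involution (sigma := sigma)
    A_tabular alpha_aut alpha_star f_aut alphaE R).
- case=> l l' [S s] [T t] /=.
  rewrite (tens_star_extR (sigma := sigma)
             A_tabular alpha_aut alpha_star f_aut alphaE) //.
  rewrite (cell_starE (G_cellular l)).
  by rewrite (sigma_involutive (sigma := sigma)
                A_tabular alpha_aut alpha_star f_aut alphaE).
- move=> x a.
  have D_mul l (l' : L' l) g := cell_mul (G_cellular l) l' g.
  exact: (tab_cell_mul b_basis sigma D_basis (tab_mul A_tabular) D_mul x a).
Qed.
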